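(* For integers $n \ge 1$ and $m \ge 1$, let $Q_{n,m}$ be the number of distinct quiddities (as ordered $(n+2)$-tuples, with the vertices of the polygon labelled in cyclic order) of $3$-periodic dissections of the convex $(n+2)$-gon into $m$ cells. Then $Q_{n,m}=0$ unless $n \equiv m \pmod 3$, and if $n \equiv m \pmod 3$ then $$Q_{n,m} = \sum_{0 \le s \le (n-m)/3} \frac{n-m-3s+2}{n-s+1}\binom{m+s-2}{s}\binom{n+m-s-1}{m-1},$$ where the sum is over integers $s$ (and is empty, hence $0$, when $m>n$).
   Context: A dissection of a convex polygon is a partition of it into sub-polygons (cells) by a set of pairwise non-crossing diagonals; a dissection is determined by its set of diagonals. The quiddity of a dissection of the $N$-gon with vertices $1,\dots,N$ in cyclic order is the $N$-tuple $(c_1,\dots,c_N)$, where $c_i$ is the number of cells having vertex $i$ as one of their vertices. A dissection is $\ell$-periodic if the number of vertices of every cell is congruent to $3$ modulo $\ell$; in particular it is $3$-periodic if every cell has a number of vertices divisible by $3$. *)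

(* Defs.v *)
(* Combinatorial model of dissections of a convex N-gon
   with vertices 'I_N = {0,...,N-1} in cyclic order. *)
From mathcomp Require Import all_boot all_order all_algebra.
Set Implicit Arguments. Unset Strict Implicit. Unset Printing Implicit Defensive.

Section Dissections.
Variable N : nat.
Implicit Types (a b c : 'I_N) (p q : 'I_N * 'I_N).

(* c lies strictly inside the cyclic (counterclockwise) arc going from a to b *)
Definition cyc_between a b c : bool :=
  let d (x : 'I_N) := (x + N - a) %% N in (0 < d c) && (d c < d b).

Definition side a b : bool :=
  (nat_of_ord b == a.+1 %% N) || (nat_of_ord a == b.+1 %% N).

Definition is_diag p : bool := (p.1 < p.2) && ~~ side p.1 p.2.

Definition cross p q : bool :=
  ((p.1 < q.1 < p.2) && (p.2 < q.2)) || ((q.1 < p.1 < q.2) && (q.2 < p.2)).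

Definition is_dissection (D : {set 'I_N * 'I_N}) : bool :=
  [forall p in D, is_diag p] && [forall p in D, forall q in D, ~~ cross p q].

Definition in_D (D : {set 'I_N * 'I_N}) a b : bool :=
  ((a, b) \in D) || ((b, a) \in D).

Definition consec (C : {set 'I_N}) a b : bool :=
  [&& a \in C, b \in C, a != b & [forall c in C, ~~ cyc_between a b c]].

(* C is (the vertex set of) a cell of D: the sub-polygon conv(C) is bounded by
   sides/diagonals of D and no diagonal of D passes through its interior
   (i.e. no diagonal of D joins two non-consecutive vertices of C). *)
Definition is_cell (D : {set 'I_N * 'I_N}) (C : {set 'I_N}) : bool :=
  [&& 3 <= #|C|,
      [forall a in C, forall b in C, consec C a b ==> (side a b || in_D D a b)] &
      [forall a in C, forall b in C,
         [&& a != b, ~~ consec C a b & ~~ consec C b a] ==> ~~ in_D D a b]].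

Definition cells (D : {set 'I_N * 'I_N}) : {set {set 'I_N}} :=
  [set C : {set 'I_N} | is_cell D C].

Definition quiddity (D : {set 'I_N * 'I_N}) : seq nat :=
  [seq #|[set C in cells D | i \in C]| | i <- enum 'I_N].

Definition three_periodic (D : {set 'I_N * 'I_N}) : bool :=
  [forall C in cells D, 3 %| #|C|].

End Dissections.

Definition Q (n m : nat) : nat :=
  size (undup [seq quiddity D | D <- enum [set D : {set 'I_(n.+2) * 'I_(n.+2)} |
     [&& is_dissection D, three_periodic D & #|cells D| == m]]]).

(* Main.v *)
(**
Encode a quiddity (c_1, ..., c_N) as the word V W^(c_1 - 1) ... V W^(c_N - 1). A
3-periodic dissection arises from one polygon by gluing polygons with 3d vertices
onto sides other than the base side, and each gluing replaces a non-initial letter V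
by W V^(3d - 1) W. In PSL(2,Z) = <S, U | S^2 = U^3 = 1> put V = U and W = SU: then
W V^(3d - 1) W = V, and the normal form theorem for the free product shows that a
word beginning with V is the word of a quiddity exactly when it equals 1. The number
m of cells is read off the number 2(m - 1) of letters W.

Words equal to 1 are closed walks in the tree of triangles (the cosets of <U>). Walks
are parsed deterministically by the grammar T -> V | W T T E, E -> V T T E | W, and a
closed walk starting with V is V followed by 3d - 1 symbols T. With x marking V and y
marking W, the generating functions satisfy t = x + y t^2 e and e = y + x t^2 e, so
Lagrange-Good inversion yields the coefficients of t^j e^i; these closed forms are
checked against the recurrences given by the first letter of the word.
*)
Require Import Defs.
From mathcomp Require Import all_boot all_order all_algebra.
From mathcomp Require Import zify ring.
Set Implicit Arguments. Unset Strict Implicit. Unset Printing Implicit Defensive.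
Import GRing.Theory Num.Theory.

(** * Walks in the tree of triangles *)

(* The vertex [(p, st)] of the tree: [p] is the corner of the current triangle,
   counted from the corner of entry, and [st] lists the corners through which the
   walk left the triangles that it has to come back through, the base one last. *)
Definition state := ('I_3 * seq 'I_3)%type.

Definition origin : state := (0%R, [::]).

Definition turn (x : state) : state := ((x.1 + 1)%R, x.2).

Definition cross_side (x : state) : state :=
  if (x.2, x.1 == 0%R) is (q :: st, true) then (q, st) else (0%R, x.1 :: x.2).

Lemma cross_side_push x : (x.1 != 0%R) || nilp x.2 -> cross_side x = (0%R, x.1 :: x.2).
Proof. by case: x => p [|q st] //=; rewrite orbF /cross_side /= => /negPf->. Qed.

(* The letters V = U and W = SU are [true] and [false]. *)
Definition step (x : state) (b : bool) : state := turn (if b then x else cross_side x).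

Definition run : state -> seq bool -> state := foldl step.

Lemma run_cat x u v : run x (u ++ v) = run (run x u) v.
Proof. exact: foldl_cat. Qed.

Lemma run_nseq_true x k : run x (nseq k true) = ((x.1 + k%:R)%R, x.2).
Proof.
elim: k x => [|k IH] [p st] /=; first by rewrite addr0.
by rewrite IH /= -addrA nat1r.
Qed.

Lemma natr_I3_eq0 k : (k%:R == 0 :> 'I_3)%R = (3 %| k).
Proof. by rewrite -(dvdn_pcharf (pchar_Fp (isT : prime 3))). Qed.

Lemma run_full_turns x d : run x (nseq (3 * d) true) = x.
Proof.
have /eqP d0 : ((3 * d)%:R == 0 :> 'I_3)%R by rewrite natr_I3_eq0 dvdn_mulr.
by case: x => p st; rewrite run_nseq_true d0 addr0.
Qed.

(* A walk pushes the corner 0 only from the base triangle; the [1] that pads the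
   stack stands for nothing and always passes the test. *)
Definition reduced (x : state) : bool := all (predC1 0%R) (belast 1%R x.2).

Lemma reduced_cross_side x : reduced x -> reduced (cross_side x).
Proof.
case: x => p [|q st] //; rewrite /cross_side /reduced /=.
case: (eqVneq p 0%R) => [_|p0] /= xr; last by rewrite p0.
by case: st xr => //= r st /andP[].
Qed.

Lemma reduced_run x w : reduced x -> reduced (run x w).
Proof.
elim: w x => //= b w IH x xr; apply: IH.
by case: b => //; apply: (reduced_cross_side xr).
Qed.

Lemma cross_sideK x : reduced x -> cross_side (cross_side x) = x.
Proof.
case: x => p [|q st] xr //; rewrite /cross_side /=.
case: (eqVneq p 0%R) xr => [-> | _ //]; case: st => [|r st] //.
by rewrite /reduced /= => /andP[/negPf-> _].
Qed.

Definition ear_word d : seq bool := false :: nseq (3 * d).+2 true ++ [:: false].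

Lemma run_ear_word x d : reduced x -> run x (ear_word d) = step x true.
Proof.
move=> xr; rewrite /ear_word -cat_cons run_cat.
rewrite -[run x _]/(run (cross_side x) (nseq (3 * d).+3 true)).
have -> : (3 * d).+3 = 3 * d.+1 by lia.
by rewrite run_full_turns /= /step cross_sideK.
Qed.

Lemma run_glue u d v : run origin (u ++ ear_word d ++ v) = run origin (u ++ true :: v).
Proof. by rewrite !run_cat run_ear_word ?reduced_run. Qed.

Definition has_ear (w : seq bool) : Prop := exists u d v, w = u ++ ear_word d ++ v.

Lemma has_ear_catl u w : has_ear w -> has_ear (u ++ w).
Proof. by case=> u' [d [v ->]]; exists (u ++ u'), d, v; rewrite catA. Qed.

Lemma nseq_shift (T : Type) n (x : T) s : nseq n x ++ x :: s = x :: nseq n x ++ s.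
Proof. by elim: n => //= n ->. Qed.

(* The normal form argument: if the number of letters V between two letters W is
   not 2 mod 3, then the second W goes deeper, so the walk cannot come back up. *)
Lemma pop_has_ear k st w : 0 < k -> size (run (k%:R%R, st) w).2 < size st ->
  has_ear (false :: nseq k.-1 true ++ w).
Proof.
elim: w k st => [|[] w IH] k st k0 /=; first by rewrite ltnn.
  rewrite /step /turn /= natr1 => /(IH k.+1 st isT).
  by case: k k0 => // k _; rewrite /= nseq_shift.
have [k3|kN3] := boolP (3 %| k).
  have -> : k.-1 = (3 * (k %/ 3).-1).+2 by lia.
  by exists [::], (k %/ 3).-1, w; rewrite /ear_word /= -catA.
rewrite /step cross_side_push ?natr_I3_eq0 ?kN3 // /turn /= add0r => pop.
apply: (@has_ear_catl (false :: nseq k.-1 true)).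
exact: IH 1 (_ :: st) isT (ltnW pop).
Qed.

Lemma closed_has_ear p w : false \in w -> run (p, [::]) w = origin -> has_ear w.
Proof.
elim: w p => // -[] w IH p /=.
  by move=> /IH wE /wE; apply: (@has_ear_catl [:: true]).
rewrite /step cross_side_push ?orbT // /turn /= add0r => _ w0.
by apply: (@pop_has_ear 1 [:: p]) => //; rewrite w0.
Qed.

(** * Words of quiddities *)

(* The base side joins the last vertex to the first; [EarGlue] glues a polygon with
   3 (d + 1) vertices onto the side between the vertices counted by [a] and [b]. *)
Inductive ear_seq : nat -> seq nat -> Prop :=
| EarRoot d : ear_seq 1 (nseq (3 * d.+1) 1)
| EarGlue k d s1 a b s2 : ear_seq k (s1 ++ a :: b :: s2) ->
    ear_seq k.+1 (s1 ++ a.+1 :: nseq (3 * d).+1 1 ++ b.+1 :: s2).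

Lemma ear_seq_size k s : ear_seq k s -> 3 <= size s.
Proof.
elim=> [d|{}k d s1 a b s2 _]; first by rewrite size_nseq; lia.
by rewrite !(size_cat, size_nseq, size_cat) /= size_cat size_nseq /=; lia.
Qed.

Definition positive (s : seq nat) : bool := all (leq 1) s.

Lemma ear_seq_positive k s : ear_seq k s -> positive s.
Proof.
rewrite /positive; elim=> [d|{}k d s1 a b s2 _]; first by rewrite all_nseq orbT.
by rewrite !all_cat /= all_cat all_nseq orbT /= => /and4P[-> _ _ ->].
Qed.

Lemma ear_seq_sumn k s : ear_seq k s -> sumn s + 2 = size s + 2 * k.
Proof.
elim=> [d|{}k d s1 a b s2 _]; first by rewrite sumn_nseq size_nseq; lia.
by rewrite !(sumn_cat, size_cat) /= !(sumn_cat, size_cat) /= sumn_nseq size_nseq; lia.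
Qed.

Definition word (s : seq nat) : seq bool :=
  flatten [seq true :: nseq c.-1 false | c <- s].

Lemma word_cat s t : word (s ++ t) = word s ++ word t.
Proof. by rewrite /word map_cat flatten_cat. Qed.

Lemma word_cons c s : word (c :: s) = true :: nseq c.-1 false ++ word s.
Proof. by []. Qed.

Lemma word_nseq1 n : word (nseq n 1) = nseq n true.
Proof. by elim: n => //= n <-. Qed.

Lemma count_true_word s : count id (word s) = size s.
Proof. by elim: s => //= c s IH; rewrite count_cat count_nseq IH. Qed.

Lemma count_false_word s : positive s -> count negb (word s) + size s = sumn s.
Proof.
elim: s => //= c s IH /andP[c_gt0 /IH]; rewrite count_cat count_nseq /= -/(word s); lia.
Qed.

(* The first component counts the letters W in front of the first V. *)
Definition unword (w : seq bool) : nat * seq nat :=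
  foldr (fun b x => if b : bool then (0, x.1.+1 :: x.2) else (x.1.+1, x.2)) (0, [::]) w.

Lemma unwordK w : nseq (unword w).1 false ++ word (unword w).2 = w.
Proof. by elim: w => // -[] w IH; rewrite -[in RHS]IH. Qed.

Lemma positive_unword w : positive (unword w).2.
Proof. by elim: w => // -[]. Qed.

Lemma word_surj w : head true w -> exists2 s, positive s & word s = w.
Proof.
move=> w1; exists (unword w).2; first exact: positive_unword.
by have := unwordK w; case: (unword w).1 w1 => // k + wE; rewrite -wE.
Qed.

Lemma wordK s : positive s -> unword (word s) = (0, s).
Proof.
elim: s => //= c s IH /andP[c_gt0 /IH sE].
have unword_nseq k : unword (nseq k false ++ word s) = (k, s).
  by elim: k => [|k IHk] //=; rewrite IHk.
by rewrite unword_nseq /= prednK.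
Qed.

Lemma word_inj : {in positive &, injective word}.
Proof. by move=> s t sp tp st; have [] : (0, s) = (0, t) by rewrite -!wordK // st. Qed.

Lemma word_glue s1 a d b s2 :
  word (s1 ++ a.+2 :: nseq (3 * d).+1 1 ++ b.+2 :: s2) =
  word (rcons s1 a.+1) ++ ear_word d ++ behead (word (b.+1 :: s2)).
Proof.
rewrite /ear_word; move: (3 * d) => n; rewrite -cats1 !(word_cat, word_cons, word_nseq1).
by rewrite /= cats0 -!catA /= -(nseq_shift a false) (nseq_shift n true).
Qed.

Lemma has_ear_word s : positive s -> has_ear (word s) ->
  exists s1 a d b s2, s = s1 ++ a.+2 :: nseq (3 * d).+1 1 ++ b.+2 :: s2.
Proof.
move=> sp [u [d [v sE]]].
have [|us /[swap] uE] := @word_surj u.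
  by case: u sE => //= b u; case: (s) => // c t [<-].
case/lastP: us uE => [|s1 a] uE; first by move: sE; rewrite -uE; case: (s).
rewrite /positive all_rcons; case: a uE => // a uE /andP[_ s1p].
have [t + vE] := @word_surj (true :: v) isT; case: t vE => [|[|b] s2] //= -[vE] s2p.
exists s1, a, d, b, s2; apply: word_inj => //; last by rewrite word_glue uE sE -vE.
by rewrite unfold_in /positive all_cat /= all_cat all_nseq orbT /= s1p.
Qed.

Lemma word_all_true s : positive s -> false \notin word s -> s = nseq (size s) 1.
Proof.
elim: s => //= -[|[|c]] s IH //= sp.
by rewrite in_cons /= => /(IH sp) {1}->.
Qed.

Lemma run_word_glue s1 a d b s2 :
  run origin (word (s1 ++ a.+2 :: nseq (3 * d).+1 1 ++ b.+2 :: s2)) =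
  run origin (word (s1 ++ a.+1 :: b.+1 :: s2)).
Proof.
by rewrite word_glue run_glue -[true :: _]/(word (b.+1 :: s2)) -word_cat cat_rcons.
Qed.

Lemma ear_seq_run k s : ear_seq k s -> run origin (word s) = origin.
Proof.
elim=> [d|{}k d s1 a b s2 ks IH]; first by rewrite word_nseq1 run_full_turns.
move: (ear_seq_positive ks) IH; rewrite /positive all_cat /= => /and4P[_].
by case: a b {ks} => [|a] [|b] // _ _ _; rewrite run_word_glue.
Qed.

Lemma run_ear_seq s : s != [::] -> positive s -> run origin (word s) = origin ->
  exists k, ear_seq k s.
Proof.
have [n] := ubnP (size s); elim: n s => // n IH s sn s0 sp sr.
have [sF|/(word_all_true sp) sE] := boolP (false \in word s).
  have [s1 [a [d [b [s2 sE]]]]] := has_ear_word sp (closed_has_ear sF sr).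
  move: sn sp sr; rewrite {}sE {s s0 sF} run_word_glue => sn sp sr.
  have [|||//|k kE] := IH (s1 ++ a.+1 :: b.+1 :: s2).
  - by move: sn; rewrite !size_cat /= size_cat size_nseq /=; lia.
  - by case: (s1).
  - by move: sp; rewrite /positive !all_cat /= all_cat => /and4P[-> _ _].
  by exists k.+1; apply: EarGlue.
move: sr s0; rewrite sE word_nseq1 run_nseq_true => /(congr1 fst)/eqP.
rewrite add0r natr_I3_eq0 => /dvdnP[[|d] ->] // _.
by exists 1; rewrite mulnC; apply: EarRoot.
Qed.

Lemma ear_seqP k s : ear_seq k s <->
  [/\ s != [::], positive s, run origin (word s) = origin & sumn s + 2 = size s + 2 * k].
Proof.
split=> [ks|[s0 sp sr sk]].
  split; [by case: s ks => // /ear_seq_size|exact: ear_seq_positive ks|..].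
    exact: ear_seq_run ks.
  exact: ear_seq_sumn ks.
have [k' k's] := run_ear_seq s0 sp sr.
by have -> : k = k' by have := ear_seq_sumn k's; lia.
Qed.

(** * Counting closed walks *)

Section Counting.
Local Open Scope ring_scope.

Definition lag (V : nmodType) (F : nat -> V) (n : nat) : V :=
  if n is n'.+1 then F n' else 0.

Lemma lagS (V : nmodType) (F : nat -> V) n : lag F n.+1 = F n.
Proof. by []. Qed.

Lemma lag_sum (V : nmodType) (F : nat -> nat -> V) B n :
  lag (fun m => \sum_(d < B) F d m) n = \sum_(d < B) lag (F d) n.
Proof. by case: n => //=; rewrite big1. Qed.

Lemma natr_binS n m : 'C(n.+1, m)%:R = 'C(n, m)%:R + lag (fun l => 'C(n, l)%:R) m :> rat.
Proof. by case: m => [|m] /=; rewrite ?bin0 ?addr0 // binS natrD. Qed.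

(* The number of words derived from j symbols T and i symbols E with k uses of
   T -> W T T E and q uses of E -> V T T E; such words have j + k + 3q letters V and
   i + 2k letters W. In all, N = 2(k + q) + j symbols T and M = i + k + q symbols E are
   expanded, and the Lagrange-Good determinant 1 - 2A - B, where A and B mark one use
   of either rule, gives C(N, k) C(M - 1, q) - 2 C(N - 1, k - 1) C(M, q). *)
Definition parse_term (j i k q : nat) : rat :=
  'C(2 * (k + q) + j, k)%:R * 'C((i + k + q).-1, q)%:R
  - 2 * lag (fun l => 'C((2 * (k + q) + j).-1, l)%:R) k * 'C(i + k + q, q)%:R.

Lemma parse_term_side j i k q :
  parse_term j.+1 i k q =
  parse_term j i k q + lag (fun k' => parse_term j.+2 i.+1 k' q) k.
Proof.
case: k => [|k] /=; first by rewrite /parse_term /= !bin0 addr0.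
rewrite /parse_term.
have -> : (2 * (k.+1 + q) + j = (2 * (k + q) + j).+2)%N by lia.
have -> : (2 * (k.+1 + q) + j.+1 = (2 * (k + q) + j).+3)%N by lia.
have -> : (2 * (k + q) + j.+2 = (2 * (k + q) + j).+2)%N by lia.
rewrite !(addSn, addnS) /= (natr_binS _.+2 k.+1) /= (natr_binS _.+1 k).
ring.
Qed.

Lemma parse_term_exit j i k q :
  parse_term j i.+1 k q =
  lag (fun q' => parse_term j.+2 i.+1 k q') q + parse_term j i k q.
Proof.
case: q => [|q] /=; first by rewrite /parse_term !bin0 add0r.
rewrite /parse_term.
have -> : (2 * (k + q.+1) + j = (2 * (k + q) + j).+2)%N by lia.
have -> : (2 * (k + q) + j.+2 = (2 * (k + q) + j).+2)%N by lia.
rewrite !(addSn, addnS) /= !(natr_binS _ q.+1) /=.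
ring.
Qed.

Lemma parse_term_sidesE j k q : (0 < j + k + q)%N ->
  parse_term j 0 k q =
  j%:R / (j + k + 2 * q)%:R * 'C((k + q).-1, q)%:R * 'C((2 * (k + q) + j).-1, k)%:R.
Proof.
rewrite /parse_term; case: k => [|k] jkq.
  rewrite !bin0 mulr0 mul0r subr0 mul1r mulr1 !addn0 add0n; case: q jkq => [|q] jkq.
    by rewrite muln0 addn0 bin0 divff // pnatr_eq0; lia.
  by rewrite bin_small // mulr0.
have -> : (2 * (k.+1 + q) + j = (2 * (k + q) + j.+1).+1)%N by lia.
rewrite lagS natr_binS lagS addSn !succnK; set M := (2 * _ + _)%N.
have MkE : 'C(M, k)%:R = k.+1%:R * 'C(M, k.+1)%:R / (j + k.+1 + 2 * q)%:R :> rat.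
  rewrite -natrM mul_bin_left natrM.
  have -> : (M - k = j + k.+1 + 2 * q)%N by rewrite /M; lia.
  by rewrite mulrC mulKf // pnatr_eq0; lia.
have kqE : 'C((k + q).+1, q)%:R = (k + q).+1%:R * 'C(k + q, q)%:R / k.+1%:R :> rat.
  rewrite -natrM (mul_bin_down (k + q).+1 q) natrM.
  have -> : ((k + q).+1 - q = k.+1)%N by lia.
  by rewrite mulrC mulKf ?pnatr_eq0.
rewrite MkE kqE; clearbody M; field.
by rewrite !nat1r -natrM -!natrD !pnatr_eq0 addnS.
Qed.

Definition parse_count (j i a b : nat) : rat :=
  let k := (b - i)./2 in let q := ((a - j - k) %/ 3)%N in
  if (a == j + k + 3 * q)%N && (b == i + 2 * k)%N then parse_term j i k q else 0.

Lemma parse_countE j i k q :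
  parse_count j i (j + k + 3 * q) (i + 2 * k) = parse_term j i k q.
Proof.
rewrite /parse_count; have -> : (i + 2 * k - i)./2 = k by lia.
by have -> : ((j + k + 3 * q - j - k) %/ 3 = q)%N; [lia | rewrite !eqxx].
Qed.

Lemma parse_count_eq0 j i a b :
  (forall k q, a = j + k + 3 * q -> b <> i + 2 * k)%N -> parse_count j i a b = 0.
Proof. by move=> abN; rewrite /parse_count; case: ifP => // /andP[/eqP/abN + /eqP]. Qed.

Variant parse_count_spec j i : nat -> nat -> rat -> Type :=
| ParseCountTerm k q :
    parse_count_spec j i (j + k + 3 * q) (i + 2 * k) (parse_term j i k q)
| ParseCountZero a b of (forall k q, a = j + k + 3 * q -> b <> i + 2 * k)%N :
    parse_count_spec j i a b 0.

Lemma parse_countP j i a b : parse_count_spec j i a b (parse_count j i a b).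
Proof.
rewrite /parse_count; set k := _./2; set q := (_ %/ 3)%N.
case: ifP => [/andP[/eqP aE /eqP bE]|abN].
  by clearbody k q; rewrite aE bE; constructor.
by constructor => k' q' aE bE; move: abN; rewrite /q /k; lia.
Qed.

Lemma parse_count_side j i a b : parse_count j.+1 i a b =
  lag (fun a' => parse_count j i a' b) a + lag (fun b' => parse_count j.+2 i.+1 a b') b.
Proof.
case: parse_countP => [k q|{}a {}b abN].
  rewrite parse_term_side !addSn lagS parse_countE; congr (_ + _); case: k => [|k] /=.
    by case bE: (i + 2 * 0)%N => [|b'] //=; rewrite parse_count_eq0 // => k' q'; lia.
  have -> : (i + 2 * k.+1 = (i.+1 + 2 * k).+1)%N by lia.
  have -> : ((j + k.+1 + 3 * q).+1 = j.+2 + k + 3 * q)%N by lia.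
  by rewrite lagS parse_countE.
case: a b abN => [|a] [|b] abN; rewrite /= ?parse_count_eq0 ?addr0 // => k q aE bE.
all: by case: (abN k q); lia || case: (abN k.+1 q); lia.
Qed.

Lemma parse_count_exit j i a b : parse_count j i.+1 a b =
  lag (fun a' => parse_count j.+2 i.+1 a' b) a + lag (fun b' => parse_count j i a b') b.
Proof.
case: parse_countP => [k q|{}a {}b abN].
  rewrite parse_term_exit !addSn lagS parse_countE; congr (_ + _); case: q => [|q] /=.
    by case aE: (j + k + 3 * 0)%N => [|a'] //=; rewrite parse_count_eq0 // => k' q'; lia.
  have -> : (j + k + 3 * q.+1 = (j.+2 + k + 3 * q).+1)%N by lia.
  by rewrite lagS parse_countE.
case: a b abN => [|a] [|b] abN; rewrite /= ?parse_count_eq0 ?addr0 // => k q aE bE.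
all: by case: (abN k q); lia || case: (abN k q.+1); lia.
Qed.

Definition words (n : nat) : seq (seq bool) :=
  iter n (fun ws => [seq b :: w | b <- [:: true; false], w <- ws]) [:: [::]].

Lemma mem_words n w : (w \in words n) = (size w == n).
Proof.
elim: n w => [|n IH] w; first by case: w.
apply/allpairsP/idP => [[[b v] /= [_ vn ->]]|]; first by rewrite /= eqSS -IH.
by case: w => // b w; rewrite eqSS -IH => wn; exists (b, w); case: b.
Qed.

Lemma words_uniq n : uniq (words n).
Proof.
elim: n => //= n IH; apply: (allpairs_uniq (isT : uniq [:: true; false]) IH).
by move=> [? ?] [? ?] _ _ [-> ->].
Qed.

Definition return_words (x : state) (a b : nat) : seq (seq bool) :=
  [seq w <- words (a + b) | (count id w == a) && (run x w == origin)].

Lemma mem_return_words x a b w : (w \in return_words x a b) =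
  [&& count id w == a, count negb w == b & run x w == origin].
Proof.
rewrite mem_filter mem_words -(count_predC id w) andbAC -!andbA.
by case: eqP => //= ->; rewrite eqn_add2l.
Qed.

Lemma return_words_uniq x a b : uniq (return_words x a b).
Proof. exact/filter_uniq/words_uniq. Qed.

Definition return_count (x : state) (a b : nat) : nat := size (return_words x a b).

Lemma return_count00 x : return_count x 0 0 = (x == origin).
Proof. by rewrite /return_count /return_words /=; case: eqP. Qed.

Lemma return_count_rec x a b : (0 < a + b)%N ->
  (return_count x a b)%:R = lag (fun a' => (return_count (step x true) a' b)%:R) a +
    lag (fun b' => (return_count (step x false) a b')%:R) b :> rat.
Proof.
case abE: (a + b)%N => [|n] // _.
rewrite /return_count /return_words size_filter abE /= cats0 count_cat !count_map natrD.
congr (_ + _).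
  case: a abE => [|a] abE /=.
    by rewrite (@eq_count _ _ pred0) ?count_pred0.
  by rewrite size_filter; have -> : n = (a + b)%N by lia.
case: b abE => [|b] abE /=.
  rewrite addn0 in abE; rewrite (@eq_in_count _ _ pred0) ?count_pred0 // => w.
  rewrite mem_words => /eqP wn /=; apply/negP => /andP[/eqP wa _].
  by move: (count_size id w); rewrite wn -[count id w]add0n wa abE ltnn.
by rewrite size_filter; have -> : n = (a + b)%N by lia.
Qed.

(* The number of sides that the walk has to go along before it can return, not
   counting full turns around the base triangle; a walk that comes back through
   the corner [q] continues from the corner [q + 1]. *)
Definition pending_sides (x : state) : nat :=
  (nat_of_ord (- x.1) + \sum_(q <- x.2) nat_of_ord (- (q + 1)))%N.

Lemma pending_sides_turn (x : state) :
  x.1 != 0 -> pending_sides x = (pending_sides (turn x)).+1.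
Proof. by case: x => [[[|[|[|p]]] p3] st]. Qed.

Lemma pending_sides_enter p st :
  pending_sides (1, p :: st) = (pending_sides (0, p :: st)).+2.
Proof. by []. Qed.

Lemma pending_sides_exit q st : pending_sides (0, q :: st) = pending_sides (q + 1, st).
Proof. by rewrite /pending_sides big_cons. Qed.

Lemma parse_count_push (x : state) c a b : (x.1 != 0) || nilp x.2 ->
  parse_count (pending_sides (turn x) + c).+1 (size x.2) a b =
  lag (fun a' => parse_count (pending_sides (step x true) + c) (size x.2) a' b) a +
  lag (fun b' =>
    parse_count (pending_sides (step x false) + c) (size (step x false).2) a b') b.
Proof.
move=> xN; rewrite parse_count_side /step cross_side_push // /turn add0r.
by rewrite pending_sides_enter pending_sides_exit.
Qed.

Lemma parse_count00 a b : (0 < a + b)%N -> parse_count 0 0 a b = 0.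
Proof.
case: parse_countP => // k q ab_gt0; rewrite parse_term_sidesE ?mul0r //; lia.
Qed.

(* Here [d] stands for the number of full turns around the base triangle. *)
Definition parse_sum (B : nat) (x : state) (a b : nat) : rat :=
  \sum_(d < B) parse_count (pending_sides x + 3 * d) (size x.2) a b.

Lemma parse_sum_origin B x a b : x.1 = 0 -> nilp x.2 -> (0 < a + b)%N -> (a < 3 * B)%N ->
  parse_sum B x a b =
  \sum_(d < B) parse_count (pending_sides (turn x) + 3 * d).+1 (size x.2) a b.
Proof.
case: x => /= _ _ -> /nilP-> ab_gt0 aB; rewrite /parse_sum /pending_sides !big_nil /=.
pose f d := parse_count (3 * d) 0 a b.
transitivity (\sum_(d < B.+1) f d).
  rewrite big_ord_recr /= [f B]parse_count_eq0 => [|k q]; last by lia.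
  by rewrite addr0; apply: eq_bigr.
rewrite big_ord_recl [f _]parse_count00 // add0r.
by apply: eq_bigr => d _; rewrite lift0 /f mulnS.
Qed.

Lemma parse_sum_rec B x a b : (0 < a + b)%N -> (a < 3 * B)%N ->
  parse_sum B x a b = lag (fun a' => parse_sum B (step x true) a' b) a +
    lag (fun b' => parse_sum B (step x false) a b') b.
Proof.
move=> ab_gt0 aB; rewrite [in RHS]/parse_sum.
rewrite (lag_sum (fun d a' => parse_count (pending_sides (step x true) + 3 * d) _ a' b)).
rewrite (lag_sum (fun d b' => parse_count (pending_sides (step x false) + 3 * d) _ a b')).
rewrite -big_split /=.
have [xN|] := boolP ((x.1 != 0) || nilp x.2).
  under eq_bigr do rewrite -(parse_count_push _ _ _ xN).
  have [x0|x0] := eqVneq x.1 0; last by rewrite /parse_sum pending_sides_turn.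
  by rewrite parse_sum_origin //; move: xN; rewrite x0.
case: x => p [|q st]; rewrite ?orbT //= orbF negbK => /eqP->; apply: eq_bigr => d _.
rewrite parse_count_exit /step /turn /cross_side /= add0r.
by rewrite pending_sides_enter pending_sides_exit.
Qed.

Lemma parse_sum00 B x : (0 < B)%N -> parse_sum B x 0 0 = (x == origin)%:R.
Proof.
case: B => // B _; rewrite /parse_sum; case: eqP => [->|xN]; last first.
  rewrite big1 // => d _; apply: parse_count_eq0 => k q p0 s0; case: xN.
  have {p0 s0} [] : pending_sides x = 0%N /\ size x.2 = 0%N by lia.
  by case: x => [[[|[|[|p]]] p3] [|c st]] // _ _; congr (_, _); apply: val_inj.
rewrite big_ord_recl /pending_sides big_nil [X in X + _](parse_countE 0 0 0 0).
by rewrite big1 ?addr0.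
Qed.

Lemma return_countE B x a b :
  (a < 3 * B)%N -> (return_count x a b)%:R = parse_sum B x a b.
Proof.
have [n] := ubnP (a + b)%N; elim: n x a b => // n IH x a b abn aB.
have [ab0|ab_gt0] := posnP (a + b)%N.
  have [-> ->] : a = 0%N /\ b = 0%N by lia.
  by rewrite return_count00 parse_sum00 //; lia.
rewrite return_count_rec // parse_sum_rec //; congr (_ + _).
  by case: a abn aB {ab_gt0} => //= a abn aB; apply: IH; lia.
by case: b abn {ab_gt0} => //= b abn; apply: IH; lia.
Qed.

Lemma pending_sides_start : pending_sides (step origin true) = 2%N.
Proof. by rewrite /pending_sides big_nil. Qed.

Lemma closed_word_count_eq0 n m :
  (forall M, n <> m.+1 + 3 * M)%N ->
  return_count (step origin true) n.+1 (2 * m) = 0%N.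
Proof.
move=> nm; apply/eqP; rewrite -(@pnatr_eq0 rat) (return_countE (B := n.+1)); last by lia.
rewrite /parse_sum pending_sides_start big1 // => d _.
by apply: parse_count_eq0 => k q nE /= kE; apply: (nm (d + q)%N); lia.
Qed.

Lemma closed_word_countE n m M : (n = m.+1 + 3 * M)%N ->
  (return_count (step origin true) n.+1 (2 * m))%:R =
  \sum_(0 <= s < M.+1) ((3 * (M - s) + 2)%:R / (n - s + 1)%:R
    * 'C((m + s).-1, s)%:R * 'C(n + m - s, m)%:R) :> rat.
Proof.
move=> nE; rewrite (return_countE (B := n.+1)); last by lia.
pose f d := parse_count (3 * d + 2) 0 n.+1 (2 * m).
transitivity (\sum_(0 <= d < n.+1) f d).
  by rewrite big_mkord; apply: eq_bigr => d _; rewrite pending_sides_start addnC.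
rewrite (big_cat_nat (n := M.+1)) //=; last by lia.
rewrite [X in _ + X]big1_seq ?addr0 => [|d]; last first.
  by rewrite mem_index_iota => dM; apply: parse_count_eq0 => k q; lia.
rewrite big_nat_rev; apply: eq_big_nat => s sM; rewrite /f add0n subSS.
have -> : (n.+1 = 3 * (M - s) + 2 + m + 3 * s)%N by lia.
rewrite (parse_countE _ 0) parse_term_sidesE; last by lia.
by congr (_ / _%:R * _ * 'C(_, _)%:R); lia.
Qed.

End Counting.

(** * Dissections of polygons on subsets of the vertices *)

Definition in_arc (a b c : nat) : bool :=
  (a < c < b) || (b < a) && ((a < c) || (c < b)).

Lemma in_arc_left a b : in_arc a b a = false.
Proof. by rewrite /in_arc; lia. Qed.

Lemma in_arc_right a b : in_arc a b b = false.
Proof. by rewrite /in_arc; lia. Qed.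

Lemma in_arc_asym a b c : in_arc a b c -> ~~ in_arc b a c.
Proof. by rewrite /in_arc; lia. Qed.

Lemma in_arc_total a b c : a != b -> c != a -> c != b -> in_arc a b c || in_arc b a c.
Proof. by rewrite /in_arc; lia. Qed.

Lemma in_arc_ltE i j x : i < j -> in_arc i j x = (i < x < j).
Proof. by rewrite /in_arc; lia. Qed.

Lemma in_arc_gtE i j x : i < j -> in_arc j i x = (x < i) || (j < x).
Proof. by rewrite /in_arc; lia. Qed.

Lemma in_arc_over i j a b c : in_arc i j c -> ~~ in_arc i j a -> ~~ in_arc i j b ->
  in_arc a b c -> ~~ in_arc a b i -> ~~ in_arc a b j -> a = i /\ b = j.
Proof. by rewrite /in_arc; lia. Qed.

Lemma in_arc_separates i j a b x y : in_arc i j x -> in_arc j i y ->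
  in_arc a b i -> ~~ in_arc a b x -> ~~ in_arc a b y -> in_arc j i a && in_arc i j b.
Proof. by rewrite /in_arc; lia. Qed.

Definition offset (N y x : nat) : nat := (x + N - y) %% N.

Lemma offsetxx N x : offset N x x = 0.
Proof. by rewrite /offset addKn modnn. Qed.

Lemma offsetE N y x : x < N -> y < N ->
  offset N y x = if y <= x then x - y else x + N - y.
Proof.
move=> xN yN; rewrite /offset; case: leqP => xy; last by rewrite modn_small //; lia.
by have -> : x + N - y = x - y + N; [lia | rewrite modnDr modn_small //; lia].
Qed.

Lemma offset_inj N y a b : y < N -> a < N -> b < N ->
  offset N y a = offset N y b -> a = b.
Proof.
by move=> yN aN bN; rewrite !offsetE //; case: (leqP y a); case: (leqP y b); lia.
Qed.

Lemma in_arc_offset N y a b c : y < N -> a < N -> b < N -> c < N ->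
  in_arc (offset N y a) (offset N y b) (offset N y c) = in_arc a b c.
Proof.
move=> yN aN bN cN; rewrite !offsetE // /in_arc.
by case: (leqP y a); case: (leqP y b); case: (leqP y c); lia.
Qed.

Section Polygon.
Variable N : nat.
Implicit Types (a b c i j x y : 'I_N) (p q : 'I_N * 'I_N).
Implicit Types (C S : {set 'I_N}) (D : {set 'I_N * 'I_N}).

Lemma cyc_betweenE a b c : cyc_between a b c = in_arc a b c.
Proof. by rewrite -(@in_arc_offset N a) // offsetxx /in_arc ltn0 orbF. Qed.

Lemma consecP C a b :
  reflect [/\ a \in C, b \in C, a != b & {in C, forall c, ~~ in_arc a b c}]
          (consec C a b).
Proof.
apply: (iffP and4P) => -[aC bC ab abC]; split=> //.
  by move=> c cC; rewrite -cyc_betweenE; apply: (forall_inP abC).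
by apply/forall_inP => c cC; rewrite cyc_betweenE abC.
Qed.

Lemma consec_sub C S a b : C \subset S -> a \in C -> b \in C ->
  consec S a b -> consec C a b.
Proof.
move=> /subsetP CS aC bC /consecP[_ _ ab abS].
by apply/consecP; split=> // c /CS; apply: abS.
Qed.

Lemma neq_val a b : (a != b :> nat) = (a != b).
Proof. by []. Qed.

Lemma ltn_ord_neq i j : i < j -> i != j.
Proof. by move=> ij; rewrite -neq_val ltn_eqF. Qed.

Lemma not_consec C a b : a \in C -> b \in C -> a != b -> ~~ consec C a b ->
  exists2 c, c \in C & in_arc a b c.
Proof.
move=> aC bC ab; have [/exists_inP //|noC] := boolP [exists c in C, in_arc a b c].
case/negP; apply/consecP; split=> // c cC.
by apply: contraNN noC => abc; apply/exists_inP; exists c.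
Qed.

Lemma consec_opp C a b : 2 < #|C| -> consec C a b -> ~~ consec C b a.
Proof.
move=> C3 /consecP[aC bC ab abC]; apply/consecP => -[_ _ _ baC].
have /card_gt0P[c] : 0 < #|C :\ a :\ b|.
  by move: C3; rewrite (cardsD1 a) aC (cardsD1 b (C :\ a)) !inE eq_sym ab bC.
rewrite !inE => /and3P[cb ca cC].
rewrite -!neq_val in ab cb ca.
by move: (abC c cC) (baC c cC); case/orP: (in_arc_total ab ca cb) => ->.
Qed.

(* The neighbours of [y] in [C] are the vertices of [C] at the smallest and the
   largest counterclockwise distance from [y]. *)
Lemma consec_around C y : 1 < #|C| -> y \notin C ->
  exists a b, consec C a b /\ in_arc a b y.
Proof.
move=> /card_gt1P[u [v [uC vC uv]]] yC.
pose dist (x : 'I_N) := offset N y x.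
have dist_inj : injective dist by move=> x x' /offset_inj xx'; apply/val_inj/xx'.
have arcE (c d e : 'I_N) : in_arc c d e = in_arc (dist c) (dist d) (dist e).
  by rewrite in_arc_offset.
have dist_y : dist y = 0 by apply: offsetxx.
have dist_gt0 x : x \in C -> 0 < dist x.
  by move=> xC; rewrite lt0n -dist_y (inj_eq dist_inj); apply: contraNneq yC => <-.
have [a aC amax] := arg_maxnP dist uC; have [b bC bmin] := arg_minnP dist uC.
have ba : dist b < dist a.
  rewrite ltnNge; apply: contra uv => ab; apply/eqP/dist_inj.
  by move: (amax u uC) (amax v vC) (bmin u uC) (bmin v vC) => /=; lia.
exists a, b; split; last by rewrite arcE dist_y /in_arc dist_gt0 // ba orbT.
apply/consecP; split=> //; first by apply: contraTneq ba => ->; rewrite ltnn.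
by move=> c cC; rewrite arcE /in_arc; move: (amax c cC) (bmin c cC) ba => /=; lia.
Qed.

(* Polygons on arbitrary subsets S of the vertices, so that cutting a polygon along a
   diagonal needs no renumbering. *)
Definition side_in S a b : bool := consec S a b || consec S b a.

Lemma side_inC S a b : side_in S a b = side_in S b a.
Proof. exact: orbC. Qed.

Lemma side_in_sub C S a b : C \subset S -> a \in C -> b \in C ->
  side_in S a b -> side_in C a b.
Proof. by move=> CS aC bC /orP[] /(consec_sub CS) abC; rewrite /side_in abC ?orbT. Qed.

Lemma in_DC D a b : in_D D a b = in_D D b a.
Proof. exact: orbC. Qed.

Lemma in_DU D1 D2 a b : in_D (D1 :|: D2) a b = in_D D1 a b || in_D D2 a b.
Proof. by rewrite /in_D !inE orbACA. Qed.

Lemma in_D0 a b : in_D set0 a b = false.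
Proof. by rewrite /in_D !inE. Qed.

Lemma in_D1 i j a b : in_D [set (i, j)] a b = ((a, b) == (i, j)) || ((a, b) == (j, i)).
Proof. by rewrite /in_D !inE; congr (_ || _); rewrite !xpair_eqE andbC. Qed.

Definition edge S D a b : bool := side_in S a b || in_D D a b.

Definition cell_in S D C : bool :=
  [&& C \subset S, 3 <= #|C| &
      [forall a in C, forall b in C, (a != b) ==> (side_in C a b == edge S D a b)]].

Lemma cell_inP S D C :
  reflect [/\ C \subset S, 3 <= #|C| &
              {in C &, forall a b, a != b -> side_in C a b = edge S D a b}]
          (cell_in S D C).
Proof.
apply: (iffP and3P) => -[CS C3 CE]; split=> //.
  move=> a b aC bC ab; apply/eqP.
  by move/forall_inP/(_ a aC)/forall_inP/(_ b bC)/implyP: CE; apply.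
by apply/forall_inP => a aC; apply/forall_inP => b bC; apply/implyP => ab; rewrite CE.
Qed.

Definition cells_in S D : {set {set 'I_N}} := [set C | cell_in S D C].

Definition vertex_count S D x : nat := #|[set C in cells_in S D | x \in C]|.

Definition quiddity_in S D : seq nat := [seq vertex_count S D x | x <- enum S].

Definition three_periodic_in S D : Prop := {in cells_in S D, forall C, 3 %| #|C|}.

Definition diag_in S p : bool :=
  [&& p.1 \in S, p.2 \in S, p.1 < p.2 & ~~ side_in S p.1 p.2].

Definition dissection_in S D : Prop :=
  {in D, forall p, diag_in S p} /\ {in D &, forall p q, ~~ cross p q}.

Lemma diag_in_sub S S' p : S' \subset S -> diag_in S' p -> diag_in S p.
Proof.
move=> /[dup] S'S /subsetP inS /and4P[p1 p2 p12 ns]; apply/and4P; split; rewrite ?inS //.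
exact: contraNN (side_in_sub S'S p1 p2) ns.
Qed.

Lemma dissection_in0 S : dissection_in S set0.
Proof. by split=> [p|p q]; rewrite inE. Qed.

Lemma vertex_in_cell S D C y : cell_in S D C -> y \in S ->
  {in C &, forall a b, in_D D a b -> in_arc a b y -> exists2 c, c \in C & in_arc a b c} ->
  y \in C.
Proof.
move=> /cell_inP[CS C3 CE] yS Dy; apply/negPn/negP => yC.
have [a [b [ab aby]]] := consec_around (ltnW C3) yC.
have /consecP[aC bC nab abC] := ab.
have : edge S D a b by rewrite -CE // /side_in ab.
case/orP => [/orP[/consecP[_ _ _ /(_ y yS)]|/(consec_sub CS bC aC)]|/Dy Dab].
- by rewrite aby.
- by apply/negP/consec_opp.
- by have [c /abC /negP] := Dab aC bC aby.
Qed.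

Lemma cells_in0 S : 3 <= #|S| -> cells_in S set0 = [set S].
Proof.
move=> S3; apply/setP => C; rewrite !inE; apply/idP/eqP => [CS|->]; last first.
  by apply/cell_inP; split=> // a b _ _ _; rewrite /edge in_D0 orbF.
apply/eqP; rewrite eqEsubset; have /cell_inP[-> _ _] := CS.
by apply/subsetP => y yS; apply: vertex_in_cell CS yS _ => a b _ _; rewrite in_D0.
Qed.

Definition piece S i j : {set 'I_N} := [set x in S | ~~ in_arc i j x].

Lemma piece_sub S i j : piece S i j \subset S.
Proof. by apply/subsetP => x; rewrite inE => /andP[]. Qed.

Lemma piece_left S i j : (i \in piece S i j) = (i \in S).
Proof. by rewrite inE in_arc_left andbT. Qed.

Lemma piece_right S i j : (j \in piece S i j) = (j \in S).
Proof. by rewrite inE in_arc_right andbT. Qed.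

Lemma pieceI S i j x : i != j -> x \in piece S i j -> x \in piece S j i -> x = i \/ x = j.
Proof.
rewrite !inE -neq_val => ij /andP[_ xij] /andP[_ xji].
have [/val_inj|xi] := eqVneq (x : nat) i; first by left.
have [/val_inj|xj] := eqVneq (x : nat) j; first by right.
by have /orP[] := in_arc_total ij xi xj; rewrite ?(negPf xij) ?(negPf xji).
Qed.

Section Piece.
Variables (S : {set 'I_N}) (i j : 'I_N).
Hypotheses (iS : i \in S) (jS : j \in S) (ij : i != j).

Lemma consec_piece a b : a \in piece S i j -> b \in piece S i j ->
  consec (piece S i j) a b = consec S a b || ((a, b) == (i, j)).
Proof.
move=> aP bP; apply/idP/orP => [/[dup] /consecP[_ _ ab abP] abC|[|/eqP[-> ->]]].
- have [_|abN] := boolP (consec S a b); first by left.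
  have inS := subsetP (piece_sub S i j).
  have [c cS abc] := not_consec (inS a aP) (inS b bP) ab abN.
  have ijc : in_arc i j c by apply: contraTT abc => ijc; apply: abP; rewrite inE cS.
  move: aP bP (abP i) (abP j); rewrite piece_left piece_right !inE.
  move=> /andP[_ aij] /andP[_ bij] /(_ iS) abi /(_ jS) abj; right.
  by have [/val_inj-> /val_inj->] := in_arc_over ijc aij bij abc abi abj.
- exact: consec_sub (piece_sub S i j) aP bP.
- apply/consecP; split; rewrite ?piece_left ?piece_right // => c.
  by rewrite inE => /andP[].
Qed.

Lemma side_in_piece a b : a \in piece S i j -> b \in piece S i j ->
  side_in (piece S i j) a b = edge S [set (i, j)] a b.
Proof.
move=> aP bP; rewrite /edge /side_in !consec_piece // in_D1 orbACA.
by congr (_ || (_ || _)); rewrite !xpair_eqE andbC.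
Qed.

Lemma consec_piece_base : consec (piece S i j) i j.
Proof. by rewrite consec_piece ?piece_left ?piece_right ?eqxx ?orbT. Qed.

End Piece.

Lemma in_D_diag S D a b : {in D, forall p, diag_in S p} -> in_D D a b ->
  [/\ a \in S, b \in S, a != b & ~~ side_in S a b].
Proof.
move=> Dd; case/orP => /Dd /and4P[/= aS bS]; rewrite -neq_val neq_ltn => ab ns.
  by rewrite aS bS ab ns.
by rewrite aS bS ab orbT side_inC ns.
Qed.

Lemma in_D_piece S i j D a b : i \in S -> j \in S -> i != j ->
  {in D, forall p, diag_in (piece S j i) p} ->
  a \in piece S i j -> b \in piece S i j -> in_D D a b = false.
Proof.
move=> iS jS ij Dd aP bP; apply/negP => /(in_D_diag Dd)[aP' bP' ab].
have ji : consec (piece S j i) j i by apply: consec_piece_base; rewrite // eq_sym.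
move: ab; have [->|->] := pieceI ij aP aP'; have [->|->] := pieceI ij bP bP';
  rewrite ?eqxx //.
  by rewrite /side_in ji orbT.
by rewrite /side_in ji.
Qed.

Definition cut i j D1 D2 : {set 'I_N * 'I_N} := (i, j) |: (D1 :|: D2).

Lemma edge_cut S i j D1 D2 a b :
  edge S (cut i j D1 D2) a b = [|| edge S [set (i, j)] a b, in_D D1 a b | in_D D2 a b].
Proof. by rewrite /edge !in_DU !orbA. Qed.

Lemma edge_piece S i j D1 D2 : i \in S -> j \in S -> i != j ->
  {in D2, forall p, diag_in (piece S j i) p} ->
  {in piece S i j &, edge (piece S i j) D1 =2 edge S (cut i j D1 D2)}.
Proof.
move=> iS jS ij D2d a b aP bP; rewrite edge_cut (in_D_piece iS jS ij D2d aP bP) orbF.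
by rewrite {1}/edge side_in_piece.
Qed.

Lemma edge_piece_opp S i j D1 D2 : i \in S -> j \in S -> i != j ->
  {in D1, forall p, diag_in (piece S i j) p} ->
  {in piece S j i &, edge (piece S j i) D2 =2 edge S (cut i j D1 D2)}.
Proof.
move=> iS jS ij D1d a b aP bP; have ji : j != i by rewrite eq_sym.
rewrite (edge_piece _ jS iS ji D1d) // !edge_cut /edge !in_D1.
by congr [|| _ || _ | _]; apply: orbC.
Qed.

Lemma cell_in_edge S S' D D' C : S' \subset S -> C \subset S' ->
  {in S' &, edge S' D' =2 edge S D} -> cell_in S' D' C = cell_in S D C.
Proof.
move=> S'S CS' DE; apply/cell_inP/cell_inP => -[_ C3 CE]; split=> //.
- exact: subset_trans S'S.
- by move=> a b aC bC ab; rewrite -DE ?CE // (subsetP CS').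
- by move=> a b aC bC ab; rewrite DE ?CE // (subsetP CS').
Qed.

Lemma crossE p q : p.1 < p.2 -> q.1 < q.2 ->
  cross p q = in_arc q.2 q.1 p.1 && in_arc q.1 q.2 p.2
           || in_arc q.1 q.2 p.1 && in_arc q.2 q.1 p.2.
Proof. by rewrite /cross /in_arc; lia. Qed.

Lemma in_D_noncross S D a b u v : dissection_in S D -> in_D D a b -> in_D D u v ->
  ~~ (in_arc b a u && in_arc a b v).
Proof.
move=> [Dd Dnc] /orP[]abD /orP[]uvD; move: (Dnc _ _ uvD abD);
  have /and4P[/= _ _ ab _] := Dd _ abD; have /and4P[/= _ _ uv _] := Dd _ uvD;
  rewrite crossE //= negb_or => /andP[nc nc']; by [] || by rewrite andbC.
Qed.

Definition avoids_arc i j p : bool :=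
  [&& p.1 < p.2, ~~ in_arc i j p.1 & ~~ in_arc i j p.2].

Lemma diag_in_piece_avoids S i j p : diag_in (piece S i j) p -> avoids_arc i j p.
Proof.
by rewrite /avoids_arc => /and4P[]; rewrite !inE => /andP[_ ->] /andP[_ ->] ->.
Qed.

Lemma avoids_arc_noncross i j p q : i != j -> avoids_arc i j p -> avoids_arc j i q ->
  ~~ cross p q /\ ~~ cross q p.
Proof.
rewrite -neq_val => ij /and3P[p12 p1 p2] /and3P[q12 q1 q2].
by move: ij p12 p1 p2 q12 q1 q2; rewrite /cross /in_arc; split; lia.
Qed.

Lemma diag_end_in_cell S D C i j x y : dissection_in S D -> in_D D i j -> i \in S ->
  cell_in S D C -> x \in C -> in_arc i j x -> y \in C -> in_arc j i y -> i \in C.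
Proof.
move=> dD ijD iS cC xC ijx yC jiy; apply: vertex_in_cell cC iS _ => a b aC bC abD abi.
have [abx|nabx] := boolP (in_arc a b x); first by exists x.
have [aby|naby] := boolP (in_arc a b y); first by exists y.
by case/negP: (in_D_noncross dD ijD abD); apply: in_arc_separates abi nabx naby.
Qed.

(* A cell with vertices strictly on both sides of a diagonal has both ends of it as
   vertices, because no side of the cell crosses it; but then the diagonal would
   have to be a side of the cell. *)
Lemma cell_in_piece S D i j C : dissection_in S D -> (i, j) \in D -> cell_in S D C ->
  C \subset piece S i j \/ C \subset piece S j i.
Proof.
move=> dD ijD cC; have /and4P[/= iS jS ij _] := dD.1 _ ijD.
have /cell_inP[CS _ CE] := cC.
have [CP|/subsetPn[x xC]] := boolP (C \subset piece S i j); first by left.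
have [CP|/subsetPn[y yC]] := boolP (C \subset piece S j i); first by right.
rewrite !inE !(subsetP CS) //= !negbK => jiy ijx.
have ijD' : in_D D i j by rewrite /in_D ijD.
have jiD : in_D D j i by rewrite in_DC.
have iC : i \in C by apply: diag_end_in_cell dD ijD' iS cC xC ijx yC jiy.
have jC : j \in C by apply: diag_end_in_cell dD jiD jS cC yC jiy xC ijx.
have : side_in C i j by rewrite CE ?ltn_ord_neq // /edge ijD' orbT.
case/orP => /consecP[_ _ _ noC]; first by move: (noC x xC); rewrite ijx.
by move: (noC y yC); rewrite jiy.
Qed.

Section Cut.
Variables (S : {set 'I_N}) (i j : 'I_N) (D1 D2 : {set 'I_N * 'I_N}).
Hypotheses (ijS : diag_in S (i, j)) (dD1 : dissection_in (piece S i j) D1)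
  (dD2 : dissection_in (piece S j i) D2).

Lemma dissection_in_cut : dissection_in S (cut i j D1 D2).
Proof.
have [[Dd1 Dnc1] [Dd2 Dnc2]] := (dD1, dD2); have /and4P[/= _ _ ij _] := ijS.
have nij := ltn_ord_neq ij.
have ij1 : avoids_arc i j (i, j) by rewrite /avoids_arc /= in_arc_left in_arc_right ij.
have ij2 : avoids_arc j i (i, j) by rewrite /avoids_arc /= in_arc_left in_arc_right ij.
have D1P p : p \in D1 -> avoids_arc i j p by move/Dd1/diag_in_piece_avoids.
have D2P p : p \in D2 -> avoids_arc j i p by move/Dd2/diag_in_piece_avoids.
have nc p q := @avoids_arc_noncross i j p q nij.
split=> [p /setU1P[->|/setUP[/Dd1|/Dd2]]|p q] //;
  try exact: diag_in_sub (piece_sub _ _ _).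
case/setU1P=> [->|/setUP[]pD]; case/setU1P=> [->|/setUP[]qD].
- exact: (nc _ _ ij1 ij2).1.
- exact: (nc _ _ (D1P q qD) ij2).2.
- exact: (nc _ _ ij1 (D2P q qD)).1.
- exact: (nc _ _ (D1P p pD) ij2).1.
- exact: Dnc1.
- exact: (nc _ _ (D1P p pD) (D2P q qD)).1.
- exact: (nc _ _ ij1 (D2P p pD)).2.
- exact: (nc _ _ (D1P q qD) (D2P p pD)).2.
- exact: Dnc2.
Qed.

Lemma cells_in_cut :
  cells_in S (cut i j D1 D2) = cells_in (piece S i j) D1 :|: cells_in (piece S j i) D2.
Proof.
have /and4P[/= iS jS /ltn_ord_neq ij _] := ijS.
have edge1 := edge_piece D1 iS jS ij dD2.1.
have edge2 := edge_piece_opp D2 iS jS ij dD1.1.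
apply/setP => C; rewrite !inE; apply/idP/orP => [cC|[] cC].
- have ijD : (i, j) \in cut i j D1 D2 by rewrite setU11.
  have [CP|CP] := cell_in_piece dissection_in_cut ijD cC; [left|right].
    by rewrite (cell_in_edge (piece_sub S i j) CP edge1).
  by rewrite (cell_in_edge (piece_sub S j i) CP edge2).
- by have /cell_inP[CP _ _] := cC; rewrite -(cell_in_edge (piece_sub S i j) CP edge1).
- by have /cell_inP[CP _ _] := cC; rewrite -(cell_in_edge (piece_sub S j i) CP edge2).
Qed.

Lemma disjoint_cells_in_piece :
  [disjoint cells_in (piece S i j) D1 & cells_in (piece S j i) D2].
Proof.
have /and4P[/= _ _ /ltn_ord_neq ij _] := ijS; apply/pred0P => C /=; rewrite !inE.
apply/negP => /andP[/cell_inP[C1 C3 _] /cell_inP[C2 _ _]].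
have : C \subset [set i; j].
  by apply/subsetP => x xC; rewrite !inE; apply/orP;
     have [->|->] := pieceI ij (subsetP C1 x xC) (subsetP C2 x xC); [left | right].
by move/subset_leq_card; rewrite cards2 ij leqNgt C3.
Qed.

Lemma card_cells_in_cut : #|cells_in S (cut i j D1 D2)| =
  #|cells_in (piece S i j) D1| + #|cells_in (piece S j i) D2|.
Proof.
by rewrite cells_in_cut cardsU (disjoint_setI0 disjoint_cells_in_piece) cards0 subn0.
Qed.

Lemma vertex_count_cut x : vertex_count S (cut i j D1 D2) x =
  vertex_count (piece S i j) D1 x + vertex_count (piece S j i) D2 x.
Proof.
rewrite /vertex_count !setIdE cells_in_cut setIUl cardsU -setIIl.
by rewrite (disjoint_setI0 disjoint_cells_in_piece) set0I cards0 subn0.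
Qed.

End Cut.

Lemma vertex_count0 S x : 3 <= #|S| -> vertex_count S set0 x = (x \in S).
Proof.
move=> S3; rewrite /vertex_count cells_in0 // setIdE; case: (boolP (x \in S)) => xS.
  by rewrite (setIidPl _) ?cards1 // sub1set inE.
by apply/eqP; rewrite cards_eq0 setI_eq0 disjoints1 inE.
Qed.

Lemma vertex_count_out S D x : x \notin S -> vertex_count S D x = 0.
Proof.
move=> xS; apply/eqP; rewrite cards_eq0 setIdE setI_eq0.
apply/pred0P => C /=; rewrite !inE.
by apply: contraNF xS => /andP[/cell_inP[/subsetP CS _ _]]; apply: CS.
Qed.

Lemma diag_inP S i j : i < j ->
  reflect [/\ i \in S, j \in S, exists2 x, x \in S & in_arc i j x &
              exists2 y, y \in S & in_arc j i y]
          (diag_in S (i, j)).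
Proof.
move=> ij; have nij := ltn_ord_neq ij.
apply: (iffP and4P) => /= [[iS jS _]|[iS jS [x xS ijx] [y yS jiy]]].
  rewrite negb_or => /andP[nc nc']; split=> //; first exact: not_consec nc.
  by apply: not_consec nc'; rewrite // eq_sym.
split=> //; rewrite negb_or.
apply/andP; split; apply/consecP => -[_ _ _ noS].
  by move: (noS x xS); rewrite ijx.
by move: (noS y yS); rewrite jiy.
Qed.

Lemma card_piece S i j y : i \in S -> j \in S -> i != j -> y \in S -> in_arc j i y ->
  3 <= #|piece S i j|.
Proof.
move=> iS jS ij yS jiy; have yP : y \in piece S i j by rewrite inE yS in_arc_asym.
apply/card_gt2P; exists i, j, y; rewrite piece_left piece_right iS jS yP ij.
by do 2!split=> //; apply: contraTneq jiy => ->; rewrite ?in_arc_left ?in_arc_right.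
Qed.

Lemma diag_in_card_piece S i j : diag_in S (i, j) ->
  3 <= #|piece S i j| /\ 3 <= #|piece S j i|.
Proof.
move=> ijS; have /and4P[/= _ _ ij _] := ijS.
have nij := ltn_ord_neq ij.
have [iS jS [x xS ijx] [y yS jiy]] := diag_inP S ij ijS.
by split; [apply: card_piece jiy | apply: card_piece ijx; rewrite // eq_sym].
Qed.

(* A diagonal with an end strictly between [i] and [j] would be shorter than [(i, j)]. *)
Lemma dissection_in_piece S D i j : dissection_in S D -> (i, j) \in D ->
  {in D, forall p, j - i <= p.2 - p.1} -> dissection_in (piece S i j) (D :\ (i, j)).
Proof.
move=> [Dd Dnc] ijD ij_min; have /and4P[/= iS jS ij _] := Dd _ ijD.
have nij := ltn_ord_neq ij.
split=> [p|p q] /setD1P[pij pD]; last by case/setD1P=> _; apply: Dnc.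
have /and4P[p1 p2 p12 ns] := Dd p pD.
have [p1P p2P] : p.1 \in piece S i j /\ p.2 \in piece S i j.
  rewrite !inE p1 p2 /=; move: (Dnc _ _ pD ijD) (ij_min p pD); rewrite /cross /in_arc /=.
  move: pij; rewrite -pair_eqE /= negb_and -!neq_val; lia.
apply/and4P; split=> //.
rewrite side_in_piece // /edge in_D1 (negPf ns) -surjective_pairing.
by rewrite (negPf pij) /=; apply: contraTneq p12 => ->; rewrite -leqNgt ltnW.
Qed.

End Polygon.

Section WholePolygon.
Variable N : nat.
Implicit Types (a b c i j x y : 'I_N) (p q : 'I_N * 'I_N).
Implicit Types (C S : {set 'I_N}) (D : {set 'I_N * 'I_N}).
Hypothesis N_gt1 : 1 < N.

Lemma consec_setT a b : consec setT a b = (b == a.+1 %% N :> nat).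
Proof.
have sE : a.+1 %% N = if a.+1 == N then 0 else a.+1.
  case: eqP => [->|/eqP aN]; first by rewrite modnn.
  by rewrite modn_small // ltn_neqAle aN ltn_ord.
have sN : a.+1 %% N < N by rewrite ltn_mod ltnW.
apply/consecP/eqP => [[_ _]|].
  move=> + /(_ (Ordinal sN) (in_setT _)); rewrite -neq_val /= sE /in_arc.
  by move: (ltn_ord a) (ltn_ord b); case: (a.+1 =P N); lia.
rewrite sE => bE; split; rewrite ?in_setT -?neq_val //.
  by move: N_gt1 bE; case: eqP; lia.
by move=> c _; move: (ltn_ord c) bE; rewrite /in_arc; case: eqP; lia.
Qed.

Lemma side_setT a b : side a b = side_in setT a b.
Proof. by rewrite /side_in !consec_setT. Qed.

Lemma cells_setT D : cells D = cells_in setT D.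
Proof.
apply/setP => C; rewrite !inE; apply/and3P/cell_inP => -[].
  move=> C3 /forall_inP sides /forall_inP diags.
  split; rewrite ?subsetT // => a b aC bC ab.
  have CE u v : u \in C -> v \in C -> consec C u v -> edge setT D u v.
    rewrite /edge -side_setT => uC vC.
    by move/forall_inP: (sides u uC) => /(_ v vC)/implyP.
  apply/idP/idP => [/orP[/CE->//|/CE]|].
    by rewrite /edge side_inC in_DC => ->.
  case/orP => [|Dab]; first exact: (side_in_sub (subsetT C) aC bC).
  rewrite -[side_in _ _ _]negbK negb_or; apply/negP => nside.
  by move/forall_inP: (diags a aC) => /(_ b bC); rewrite ab nside Dab.
move=> _ C3 CE; split=> //; apply/forall_inP => a aC; apply/forall_inP => b bC;
  apply/implyP.
  move=> abC; have /consecP[_ _ ab _] := abC.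
  by rewrite side_setT -/(edge setT D a b) -CE // /side_in abC.
case/and3P => ab nab nba; apply: contraT; rewrite negbK => Dab.
by have := CE a b aC bC ab; rewrite /edge Dab orbT /side_in (negPf nab) (negPf nba).
Qed.

Lemma is_dissectionP D : reflect (dissection_in setT D) (is_dissection D).
Proof.
have diagE p : diag_in setT p = is_diag p by rewrite /diag_in !in_setT /is_diag side_setT.
apply: (iffP andP) => [[/forall_inP Dd /forall_inP Dnc]|[Dd Dnc]]; split.
- by move=> p /Dd; rewrite diagE.
- by move=> p q pD qD; move/forall_inP: (Dnc p pD); apply.
- by apply/forall_inP => p /Dd; rewrite diagE.
- by apply/forall_inP => p pD; apply/forall_inP => q; apply: Dnc.
Qed.

Lemma quiddity_setT D : quiddity D = quiddity_in setT D.
Proof.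
rewrite /quiddity_in enum_setT -enumT /quiddity.
by apply: eq_map => x; rewrite cells_setT.
Qed.

End WholePolygon.

(** * Quiddities and sequences of ears *)

Lemma map_const_in (T T' : eqType) (f : T -> T') c (s : seq T) :
  {in s, f =1 fun=> c} -> map f s = nseq (size s) c.
Proof.
move=> fc; rewrite -(size_map f s); apply/all_pred1P.
by rewrite all_map; apply/allP => x /fc /= ->.
Qed.

Lemma cat_cons_split (T : Type) (s : seq T) m n : size s = m + n.+1 ->
  exists s1 x s2, [/\ s = s1 ++ x :: s2, size s1 = m & size s2 = n].
Proof.
move=> sz; have := size_drop m s; rewrite sz addKn.
case sE: (drop m s) => [//|x s2] [s2_size]; exists (take m s), x, s2; split=> //.
  by rewrite -sE cat_take_drop.
by rewrite size_takel // sz leq_addr.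
Qed.

Section EarDecomposition.
Variable N : nat.
Implicit Types (i j x y : 'I_N) (C S : {set 'I_N}) (D : {set 'I_N * 'I_N}).

Lemma pairwise_enum S : pairwise (fun x y => x < y) (enum S).
Proof.
apply: (subseq_pairwise (filter_subseq _ _)).
rewrite -enumT -(pairwise_map val ltn) val_enum_ord.
by rewrite -sorted_pairwise ?iota_ltn_sorted //; apply: ltn_trans.
Qed.

Lemma enum_split S i j : i \in S -> j \in S -> i < j ->
  exists s1 e s2, enum S = s1 ++ i :: e ++ j :: s2.
Proof.
rewrite -!(mem_enum S) => iS; have := pairwise_enum S; case/splitPr: iS => s1 t.
rewrite pairwise_cat mem_cat inE allrel_consr => /and3P[/andP[/allP s1i _] _ _].
case/or3P=> [/s1i ji|/eqP-> |/splitPr[e s2]] ij.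
- by move: (ltn_trans ij ji); rewrite ltnn.
- by rewrite ltnn in ij.
- by exists s1, e, s2.
Qed.

Lemma enum_split_lt S i e j s1 s2 : enum S = s1 ++ i :: e ++ j :: s2 ->
  [/\ i < j, {in s1, forall x, x < i}, {in e, forall x, i < x < j} &
      {in s2, forall x, j < x}].
Proof.
move=> SE; have := pairwise_enum S; rewrite SE pairwise_cat /= pairwise_cat /= all_cat /=.
rewrite !allrel_consr => /and3P[/andP[/allP s1i _] _].
move=> /andP[/and3P[/allP ie ij _] /and3P[/andP[/allP ej _] _ /andP[/allP js2 _]]].
by split=> // x xe; rewrite ie ?ej.
Qed.

Lemma enum_piece S i e j s1 s2 : enum S = s1 ++ i :: e ++ j :: s2 ->
  enum (piece S i j) = s1 ++ i :: j :: s2 /\ enum (piece S j i) = i :: rcons e j.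
Proof.
move=> SE; have [ij s1i eij js2] := enum_split_lt SE.
have filterE P : enum [set x in S | P x] = filter P (enum S).
  by rewrite /enum_mem -filter_predI; apply: eq_filter => x; rewrite !inE andbC.
have eq_filterT (P : pred 'I_N) s : {in s, forall x, P x} -> filter P s = s.
  by move=> sP; apply/all_filterP/allP.
have eq_filterF (P : pred 'I_N) s : {in s, forall x, ~~ P x} -> filter P s = [::].
  by move=> sP; rewrite (eq_in_filter (a2 := pred0)) ?filter_pred0 // => x /sP/negPf.
rewrite !filterE SE !filter_cat /= !filter_cat /= !in_arc_left !in_arc_right /=; split.
- rewrite (eq_filterT _ s1) => [|x /s1i]; last by rewrite in_arc_ltE //; lia.
  rewrite (eq_filterF _ e) => [|x /eij]; last by rewrite in_arc_ltE // negbK.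
  by rewrite eq_filterT // => x /js2; rewrite in_arc_ltE //; lia.
- rewrite (eq_filterF _ s1) => [|x /s1i]; last by rewrite in_arc_gtE //; lia.
  rewrite (eq_filterT _ e) => [|x /eij]; last by rewrite in_arc_gtE //; lia.
  by rewrite eq_filterF ?cats1 // => x /js2; rewrite in_arc_gtE //; lia.
Qed.

Lemma enum_split_diag_in S i e j s1 s2 : enum S = s1 ++ i :: e ++ j :: s2 ->
  0 < size e -> 0 < size (s1 ++ s2) -> diag_in S (i, j).
Proof.
move=> SE; have [ij s1i eij js2] := enum_split_lt SE.
have memS x : (x \in S) = (x \in s1 ++ i :: e ++ j :: s2) by rewrite -SE mem_enum.
rewrite -!has_predT => /hasP[x xe _] /hasP[y + _]; rewrite mem_cat => ys.
apply/(diag_inP S ij); split; try by rewrite memS !(mem_cat, inE) eqxx ?orbT.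
  by exists x; [rewrite memS !(mem_cat, inE) xe !orbT | rewrite in_arc_ltE ?eij].
exists y; first by rewrite memS !(mem_cat, inE); case/orP: ys => ->; rewrite ?orbT.
by rewrite in_arc_gtE //; case/orP: ys => [/s1i|/js2] ->; rewrite ?orbT.
Qed.

Lemma quiddity_in0 S : 3 <= #|S| -> quiddity_in S set0 = nseq #|S| 1.
Proof.
move=> S3; rewrite /quiddity_in cardE; apply: map_const_in => x; rewrite mem_enum => xS.
by rewrite vertex_count0 // xS.
Qed.

Section Ear.
Variables (S : {set 'I_N}) (D : {set 'I_N * 'I_N}) (i j : 'I_N) (s1 e s2 : seq 'I_N).
Hypotheses (SE : enum S = s1 ++ i :: e ++ j :: s2) (ijS : diag_in S (i, j)).
Hypothesis dD : dissection_in (piece S i j) D.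
Let ear_uncut : dissection_in (piece S j i) set0 := dissection_in0 _.
Let ear_card_ge3 : 3 <= #|piece S j i| := (diag_in_card_piece ijS).2.

Lemma card_ear : #|piece S j i| = (size e).+2.
Proof. by rewrite cardE (enum_piece SE).2 /= size_rcons. Qed.

Lemma card_cells_in_ear : #|cells_in S (cut i j D set0)| = #|cells_in (piece S i j) D|.+1.
Proof.
by rewrite (card_cells_in_cut ijS dD ear_uncut) (cells_in0 ear_card_ge3) cards1 addn1.
Qed.

Lemma three_periodic_in_ear : three_periodic_in S (cut i j D set0) <->
  three_periodic_in (piece S i j) D /\ 3 %| (size e).+2.
Proof.
rewrite /three_periodic_in (cells_in_cut ijS dD ear_uncut) (cells_in0 ear_card_ge3).
rewrite -card_ear.
split=> [per|[per ear3] C /setUP[/per //|/set1P->]] //.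
by split=> [C CD|]; apply: per; rewrite inE ?CD // set11 orbT.
Qed.

Lemma quiddity_in_ear (c := vertex_count (piece S i j) D) :
  quiddity_in S (cut i j D set0) =
  map c s1 ++ (c i).+1 :: nseq (size e) 1 ++ (c j).+1 :: map c s2.
Proof.
have [ij s1i eij js2] := enum_split_lt SE.
have cE x : vertex_count S (cut i j D set0) x = c x + (x \in piece S j i).
  by rewrite (vertex_count_cut ijS dD ear_uncut) (vertex_count0 x ear_card_ge3).
have outE x : (x < i) || (j < x) -> vertex_count S (cut i j D set0) x = c x.
  by rewrite -in_arc_gtE // cE inE => ->; rewrite andbF addn0.
have /and4P[/= iS jS _ _] := ijS.
rewrite /quiddity_in SE map_cat /= map_cat /=; congr (_ ++ _ :: _ ++ _ :: _).
- by apply/eq_in_map => x /s1i xi; rewrite outE ?xi.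
- by rewrite cE piece_right iS addn1.
- apply: map_const_in => x xe; have /andP[ix xj] := eij x xe.
  rewrite cE [c x]vertex_count_out ?inE; last by rewrite in_arc_ltE // ix xj andbF.
  have xS : x \in S by rewrite -mem_enum SE !(mem_cat, inE) xe !orbT.
  by rewrite xS in_arc_gtE // !ltnNge (ltnW ix) (ltnW xj).
- by rewrite cE piece_left jS addn1.
- by apply/eq_in_map => x /js2 jx; rewrite outE ?jx ?orbT.
Qed.

End Ear.

Lemma dissection_ear_seq S D : 3 <= #|S| -> dissection_in S D -> three_periodic_in S D ->
  ear_seq #|cells_in S D| (quiddity_in S D).
Proof.
have [n] := ubnP #|D|; elim: n S D => // n IH S D Dn S3 dD per.
have [D0|[p0 p0D]] := set_0Vmem D.
  move: per; rewrite /three_periodic_in D0 cells_in0 // cards1 quiddity_in0 //.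
  move=> /(_ S (set11 S)) /dvdnP[[|k] kE]; first by rewrite kE in S3.
  by rewrite kE mulnC; apply: EarRoot.
have [[i j] ijD ij_min] := arg_minnP (fun p : 'I_N * 'I_N => p.2 - p.1) p0D.
have ijS := dD.1 _ ijD; have /and4P[/= iS jS ij _] := ijS.
have dD' := dissection_in_piece dD ijD ij_min.
have DE : D = cut i j (D :\ (i, j)) set0 by rewrite /cut setU0 setD1K.
have [s1 [e [s2 SE]]] := enum_split iS jS ij.
rewrite DE in per *.
have [per' /dvdnP[[|d] eE]] := (three_periodic_in_ear SE ijS dD').1 per => //.
rewrite (card_cells_in_ear ijS dD') (quiddity_in_ear SE ijS dD').
have -> : size e = (3 * d).+1 by lia.
apply: EarGlue; set c := vertex_count _ _.
have -> : map c s1 ++ c i :: c j :: map c s2 = quiddity_in (piece S i j) (D :\ (i, j)).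
  by rewrite /quiddity_in (enum_piece SE).1 map_cat.
apply: IH => //; last exact: (diag_in_card_piece ijS).1.
by move: Dn; rewrite (cardsD1 (i, j)) (ijD : (i, j) \in D).
Qed.

Lemma ear_seq_dissection k s S : ear_seq k s -> #|S| = size s -> exists D,
  [/\ dissection_in S D, three_periodic_in S D, #|cells_in S D| = k &
      quiddity_in S D = s].
Proof.
move=> ks; elim: ks S => [d|{}k d s1 a b s2 ks IH] S;
  rewrite !(size_cat, size_nseq) => S_size.
  have S3 : 3 <= #|S| by lia.
  exists set0; rewrite /three_periodic_in cells_in0 // cards1 quiddity_in0 // S_size.
  by split=> [|C /set1P->|//|//]; [apply: dissection_in0 | rewrite S_size dvdn_mulr].
have ks_size := ear_seq_size ks; rewrite size_cat /= in ks_size.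
have [t1 [i [t [SE t1_size t_size]]]] : exists t1 i t,
    [/\ enum S = t1 ++ i :: t, size t1 = size s1 & size t = (3 * d).+1 + (size s2).+1].
  by apply: cat_cons_split; rewrite -cardE S_size /= size_cat size_nseq.
have [e [j [t2 [tE e_size t2_size]]]] := cat_cons_split t_size; rewrite {}tE in SE.
have ijS : diag_in S (i, j).
  by apply: (enum_split_diag_in SE); rewrite ?e_size // size_cat t1_size t2_size; lia.
have [|D [dD per Dk Dq]] := IH (piece S i j).
  by rewrite cardE (enum_piece SE).1 !size_cat /= t1_size t2_size.
exists (cut i j D set0); split.
- exact: dissection_in_cut ijS dD (dissection_in0 _).
- by apply/(three_periodic_in_ear SE ijS dD); split; rewrite // e_size; lia.
- by rewrite (card_cells_in_ear ijS dD) Dk.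
rewrite (quiddity_in_ear SE ijS dD) e_size.
move/eqP: Dq; rewrite /quiddity_in (enum_piece SE).1 map_cat eqseq_cat ?size_map //=.
by rewrite !eqseq_cons => /and4P[/eqP-> /eqP-> /eqP-> /eqP->].
Qed.

End EarDecomposition.

Lemma mem_quiddities n m s : 0 < n ->
  reflect (ear_seq m s /\ size s = n.+2)
    (s \in [seq quiddity D | D <- enum [set D : {set 'I_n.+2 * 'I_n.+2} |
       [&& is_dissection D, three_periodic D & #|cells D| == m]]]).
Proof.
move=> n_gt0; have N_gt1 : 1 < n.+2 by [].
apply: (iffP mapP) => [[D]|[ks s_size]].
  rewrite mem_enum inE => /and3P[/(is_dissectionP N_gt1) dD /forall_inP per /eqP<-] ->.
  split; last by rewrite size_map size_enum_ord.
  rewrite quiddity_setT // cells_setT //; apply: dissection_ear_seq => //.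
    by rewrite cardsT card_ord.
  by move=> C; rewrite -cells_setT //; apply: per.
have [|D [dD per Dm Dq]] := @ear_seq_dissection n.+2 m s [set: 'I_n.+2] ks.
  by rewrite cardsT card_ord s_size.
exists D; last by rewrite quiddity_setT.
rewrite mem_enum inE cells_setT // Dm eqxx andbT; apply/andP.
split; first exact/(is_dissectionP N_gt1).
by apply/forall_inP => C; rewrite cells_setT //; apply: per.
Qed.

Lemma behead_wordK s : s != [::] -> true :: behead (word s) = word s.
Proof. by case: s. Qed.

Lemma mem_return_words_ear_seq n m s : s != [::] -> positive s ->
  reflect (ear_seq m.+1 s /\ size s = n.+2)
    (behead (word s) \in return_words (step origin true) n.+1 (2 * m)).
Proof.
move=> s0 sp; have wE := behead_wordK s0.
have := count_true_word s; have := count_false_word sp.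
rewrite mem_return_words -[run _ _]/(run origin (true :: behead (word s))) wE.
rewrite -{1 2}wE /= => sF sT.
apply: (iffP and3P) => [[/eqP aE /eqP bE /eqP wr]|[/ear_seqP[_ _ wr sm] s_size]].
  by split; [apply/ear_seqP; split=> //; lia | lia].
by split; [apply/eqP; lia | apply/eqP; lia | apply/eqP].
Qed.

Lemma Q_return_count n m : 0 < n ->
  Q n m.+1 = return_count (step origin true) n.+1 (2 * m).
Proof.
move=> n_gt0; rewrite /Q /return_count; set qs := [seq quiddity D | D <- _].
have qsP s : s \in undup qs -> s != [::] /\ positive s.
  by rewrite mem_undup => /(mem_quiddities _ _ n_gt0)[/ear_seqP[]].
rewrite -(size_map (behead \o word)); apply/perm_size/uniq_perm.
- rewrite map_inj_in_uniq ?undup_uniq // => s t /qsP[s0 sp] /qsP[t0 tp] /= st.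
  by apply: word_inj => //; rewrite -behead_wordK // st behead_wordK.
- exact: return_words_uniq.
move=> w; apply/mapP/idP => [[s sqs ->]|].
  have [s0 sp] := qsP s sqs; rewrite mem_undup in sqs.
  by apply/(mem_return_words_ear_seq _ _ s0 sp)/(mem_quiddities _ _ n_gt0).
have [//|[//|c s] sp wE] := @word_surj (true :: w).
rewrite -[w]/(behead (true :: w)) -wE => /mem_return_words_ear_seq-/(_ isT sp) ks.
by exists (c :: s) => //; rewrite mem_undup; apply/(mem_quiddities _ _ n_gt0).
Qed.

Theorem mainTheorem1 (n m : nat) (hn : 1 <= n) (hm : 1 <= m) :
  (n != m %[mod 3] -> Q n m = 0) /\
  (n = m %[mod 3] ->
     ((Q n m)%:R =
       \sum_(0 <= s < n.+1 | (m + 3 * s <= n)%N)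
         ((n - m - 3 * s + 2)%N%:R / (n - s + 1)%N%:R
          * ('C(m + s - 2, s))%:R * ('C(n + m - s - 1, m - 1))%:R) :> rat)%R).
Proof.
case: m hm => // m _; rewrite Q_return_count //; split=> [/eqP nm|nm].
  by apply: closed_word_count_eq0 => M; lia.
have [nltm|mlen] := ltnP n m.+1.
  rewrite closed_word_count_eq0 => [|M]; last by lia.
  by rewrite big_pred0 // => s; lia.
have nE : n = m.+1 + 3 * ((n - m.+1) %/ 3) by lia.
rewrite (closed_word_countE nE); set M := (_ %/ 3) in nE *.
rewrite (big_nat_widen 0 M.+1 n.+1); last by lia.
apply: eq_big => [s|s sM]; first by lia.
by congr (_%:R / _ * 'C(_, _)%:R * 'C(_, _)%:R)%R; lia.
Qed.
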